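(* Let $G$ be a finite group and let $r=\mathrm{rk}(G/Z(G))$. Then $|G'|\leq |G:Z(G)|^{r+1}$.
   Context: $G'$ is the derived (commutator) subgroup of $G$ and $Z(G)$ is its centre. The rank $\mathrm{rk}(H)$ of a finite group $H$ is the minimal number $r$ such that every subgroup of $H$ can be generated by $r$ elements. *)

(* Defs.v *)
From mathcomp Require Import all_boot all_fingroup all_solvable.

Set Implicit Arguments.
Unset Strict Implicit.
Unset Printing Implicit Defensive.

Local Open Scope group_scope.

(* The r generators may repeat, so this asks for a generating set of at most r
   elements. *)
Definition generated_by (gT : finGroupType) (r : nat) (H : {set gT}) : bool :=
  [exists X : {set gT}, (#|X| <= r) && (<<X>> == H)].

Definition subgroups_generated_by (gT : finGroupType) (G : {set gT}) (r : nat)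
    : bool :=
  [forall H : {group gT}, (H \subset G) ==> generated_by r H].

Lemma ex_subgroups_generated_by (gT : finGroupType) (G : {set gT}) :
  exists r, subgroups_generated_by G r.
Proof.
exists #|G|; apply/forallP=> H; apply/implyP=> sHG.
by apply/existsP; exists (H : {set gT}); rewrite subset_leq_card //= genGid.
Qed.

(* Not MathComp's 'r(G), which only looks at the ranks of the elementary abelian
   subgroups. *)
Definition rk (gT : finGroupType) (G : {set gT}) : nat :=
  ex_minn (ex_subgroups_generated_by G).

(* Main.v *)
Require Import Defs.
From mathcomp Require Import all_boot all_fingroup all_solvable.

Set Implicit Arguments.
Unset Strict Implicit.
Unset Printing Implicit Defensive.

Local Open Scope group_scope.

(** Write Z for the centre of G, Q for G / Z and r for the rank of Q.  The
    order of G' is that of its intersection with Z times that of its image in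
    Q, and the image is a subgroup of Q.  So it suffices to prove that
    [#|G' :&: Z|] divides [#|Q| ^ r], which is checked one prime at a time
    ([card_der1_cap_center_dvd]).

    Passing to a Sylow p-subgroup P is possible because the transfer from G to
    P / P' kills G' but maps a central element z of P to the class of
    [z ^+ #|G : P|].  As this index is prime to p, every element of P that lies
    in both G' and Z already lies in P' ([Sylow_der1_cap_center]).  Hence the
    p-part of [G' :&: Z] is contained in [P' :&: A], where [A = P :&: Z] is
    central in P and P / A embeds in Q; in particular P / A is generated by r
    elements.

    What remains is a statement on central extensions: if A is central in E
    and E / A is a p-group generated by d elements, then [#|E' :&: A|] divides
    [#|E / A| ^ d] ([card_der1_cap_central_dvd]).  Pick k in E whose image in
    E / A is central of order p.  Since all commutators of k are central,
    [e |-> [~ e, k]] is a homomorphism from E to A.  It kills A and its values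
    have order dividing p, so its image I is elementary abelian, generated by d
    elements, and of order at most [p ^ d].  Modulo I the element k becomes
    central, so the central subgroup can be enlarged from A to [A <*> <[k]>],
    which divides the index by p, and induction on the index applies. *)

(** * Numbers of generators *)

Lemma generated_by_grank (gT : finGroupType) (r : nat) (H : {set gT}) :
  generated_by r H -> 'm(H) <= r.
Proof.
by case/existsP=> X /andP[le_X_r /eqP <-]; apply: leq_trans (grank_min X) _.
Qed.

Lemma grank_le_rk (gT : finGroupType) (G : {set gT}) (H : {group gT}) :
  H \subset G -> 'm(H) <= rk G.
Proof.
move=> sHG; apply: generated_by_grank; rewrite /rk.
by case: ex_minnP => r /forallP/(_ H); rewrite sHG.
Qed.

Lemma homg_grank (aT rT : finGroupType) (G : {group aT}) (H : {group rT}) :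
  H \homg G -> 'm(H) <= 'm(G).
Proof. by case/homgP=> f <-; apply: morphim_grank. Qed.

(** * Commutators with an element that is central modulo A *)

Section CentralCommutators.

Variables (gT : finGroupType) (p : nat) (E A : {group gT}) (k : gT).
Hypotheses (sAZ : A \subset 'Z(E)) (Ek : k \in E).
Hypothesis sRA : [~: E, <[k]>] \subset A.

Let comm_k_central e y : e \in E -> y \in E -> commute y [~ e, k].
Proof.
move=> Ee Ey; have /centerP[_ cE] : [~ e, k] \in 'Z(E).
  by rewrite (subsetP sAZ) ?(subsetP sRA) ?mem_commg ?cycle_id.
exact/esym/cE.
Qed.

Let comm_k_morph : {in E &, {morph commg^~ k : x y / x * y}}.
Proof.
move=> x y Ex Ey; rewrite commMgJ; congr (_ * _).
by apply/conjg_fixP/commgP/esym/comm_k_central.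
Qed.

Let f := Morphism comm_k_morph.

Let commg_cycle_morphim : [~: E, <[k]>] = f @* E.
Proof.
apply/eqP; rewrite eqEsubset; apply/andP; split; last first.
  by apply/subsetP=> _ /morphimP[e Ee _ ->]; rewrite mem_commg ?cycle_id.
rewrite gen_subG; apply/subsetP=> _ /imset2P[e _ Ee /cycleP[i ->] ->].
rewrite commgX; last exact: comm_k_central.
by rewrite groupX // (mem_morphim f).
Qed.

(** The p-th power of [[~ e, k]] is [[~ e, k ^+ p]], which is trivial because
    [k ^+ p] is central. *)
Lemma commg_cycle_abelem :
  prime p -> k ^+ p \in A -> p.-abelem [~: E, <[k]>].
Proof.
move=> p_pr Akp; apply/abelemP=> //; split.
  apply: abelianS (subset_trans sRA sAZ) (center_abelian E).
rewrite /= commg_cycle_morphim => _ /morphimP[e _ Ee ->] /=.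
rewrite -commgX; last exact: comm_k_central.
have /centerP[_ /(_ e Ee) cke] := subsetP sAZ _ Akp.
by apply/eqP/commgP/commute_sym.
Qed.

(** The homomorphism [e |-> [~ e, k]] factors through E / A, so its image needs
    no more generators than E / A. *)
Lemma grank_commg_cycle : 'm([~: E, <[k]>]) <= 'm(E / A).
Proof.
have nAE : E \subset 'N(A).
  by rewrite cents_norm // centsC (subset_trans sAZ) ?subsetIr.
have sAk : A \subset 'ker f.
  apply/subsetP=> a Aa; have /centerP[Ea cEa] := subsetP sAZ _ Aa.
  by rewrite !inE Ea /=; apply/commgP/cEa.
rewrite commg_cycle_morphim -(isog_grank (first_isog f)).
by apply: homg_grank; rewrite homg_quotientS // ker_norm.
Qed.

End CentralCommutators.

(** * Central extensions of p-groups *)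

(** Only d, the number of generators of the quotient, enters the bound; it does
    not grow when the central subgroup is enlarged, and this is why the
    induction goes through with d fixed. *)
Lemma card_der1_cap_central_dvd (p d : nat) (gT : finGroupType)
    (E A : {group gT}) :
    A \subset 'Z(E) -> p.-group (E / A) -> 'm(E / A) <= d ->
  #|E^`(1) :&: A| %| #|E : A| ^ d.
Proof.
have [m] := ubnP #|E : A|.
elim: m => // m IHm in gT E A * => leEA sAZ pQ led.
have sAE := subset_trans sAZ (center_sub E).
have nsAE : A <| E := sub_center_normal sAZ.
have [/trivgP Q1 | ntQ] := boolP (E / A \subset [1]).
  have sEZ : E \subset 'Z(E).
    by apply: subset_trans sAZ; rewrite -quotient_sub1 ?normal_norm // Q1.
  have /derG1P-> : abelian E by apply: abelianS sEZ (center_abelian E).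
  by rewrite (setIidPl _) ?sub1G // cards1 dvd1n.
rewrite subG1 in ntQ; have [p_pr _ _] := pgroup_pdiv pQ ntQ.
have ntZQ : 'Z(E / A) != 1 by rewrite center_nil_eq1 ?(pgroup_nil pQ).
have [|x Zx ox] := @Cauchy _ p 'Z(E / A)%G p_pr.
  by have [] := pgroup_pdiv (pgroupS (center_sub _) pQ) ntZQ.
have /centerP[Qx cQx] := Zx.
have /morphimP[k Nk Ek def_x] := Qx.
(* The image of e |-> [~ e, k]; it lies in A because x is central. *)
pose I := [~: E, <[k]>]%G; have nAE := normal_norm nsAE.
have sRA : I \subset A.
  rewrite -quotient_cents2 ?cycle_subG // quotient_cycle // cent_cycle.
  by apply/subsetP=> y Qy; apply/cent1P; rewrite -def_x; apply/esym/cQx.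
have Akp : k ^+ p \in A.
  by apply: coset_idr; rewrite ?groupX // morphX // -def_x -ox expg_order.
have abI := commg_cycle_abelem sAZ Ek sRA p_pr Akp.
have leI : logn p #|I| <= d.
  rewrite -rank_abelem // -grank_abelian ?(abelem_abelian abI) //.
  exact: leq_trans (grank_commg_cycle sAZ Ek sRA) led.
(* K / I is central in E / I, and E / K is smaller than E / A by a factor p. *)
pose K := (A <*> <[k]>)%G.
have sAK : A \subset K := joing_subl _ _.
have sKE : K \subset E by rewrite join_subG sAE cycle_subG.
have nIE : E \subset 'N(I) by apply: commg_norml.
have sIK : I \subset K := subset_trans sRA sAK.
have cKI : K / I \subset 'Z(E / I).
  rewrite subsetI quotientS //=.
  rewrite quotientY ?(subset_trans sAE) ?cycle_subG ?(subsetP nIE) //.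
  rewrite join_subG !quotient_cents2r //; first by rewrite commGC.
  have /commG1P-> : A \subset 'C(E) by rewrite (subset_trans sAZ) ?subsetIr.
  exact: sub1G.
have cardEA : (#|E : A| = p * #|E : K|)%N.
  rewrite -(Lagrange_index sKE sAK) mulnC -card_quotient ?(subset_trans sKE) //.
  by rewrite quotientYidl ?cycle_subG // quotient_cycle // -def_x -orderE ox.
have nKE : E \subset 'N(K).
  rewrite -commg_subr (subset_trans _ sIK) //.
  rewrite -quotient_cents2 ?(subset_trans sKE) //.
  by rewrite centsC (subset_trans cKI) ?subsetIr.
have nsKE : K <| E by apply/andP.
have isoQ : (E / I) / (K / I) \isog E / K.
  by rewrite third_isog // /normal (subset_trans sRA).
have homQ : E / K \homg E / A by rewrite homg_quotientS // normal_norm.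
have IH : #|(E / I)^`(1) :&: (K / I)| %| #|E : K| ^ d.
  rewrite -(index_quotient_eq _ sKE nIE) ?subIset ?sIK ?orbT //.
  apply: (IHm _ (E / I)%G (K / I)%G) => //.
  - rewrite index_quotient_eq ?subIset ?sIK ?orbT //.
    rewrite ltnS in leEA; apply: leq_trans leEA.
    by rewrite cardEA ltn_Pmull ?prime_gt1.
  - rewrite (isog_pgroup _ isoQ) /pgroup card_quotient //.
    by apply: pnat_dvd (indexgS E sAK) _; rewrite -card_quotient.
  by rewrite (isog_grank isoQ) (leq_trans (homg_grank homQ)).
(* The order of E' :&: K is that of I, at most p ^ d, times that of its image
   in E / I, which the induction hypothesis bounds. *)
have sIE' : I \subset E^`(1) by rewrite commgS ?cycle_subG.
rewrite cardEA expnMn.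
apply: (@dvdn_trans #|E^`(1) :&: K|); first by rewrite cardSg ?setIS.
rewrite -(Lagrange (_ : I \subset E^`(1) :&: K)) ?subsetI ?sIE' //.
rewrite dvdn_mul //.
  by rewrite (card_pgroup (abelem_pgroup abI)) dvdn_exp2l.
rewrite -card_quotient; last first.
  by rewrite (subset_trans _ nIE) // subIset ?der_sub.
apply: dvdn_trans (cardSg _) IH.
by rewrite /= -quotient_der // quotientI.
Qed.

(** * Transfer and the Sylow reduction *)

(** A central z of H fixes every right coset of H in G and commutes with the
    coset representatives, so every factor of the transfer is [alpha z]. *)
Lemma transfer_center (gT aT : finGroupType) (G H : {group gT})
    (alpha : {morphism H >-> aT}) (abA : abelian (alpha @* H)) z :
    H \subset G -> z \in H -> z \in 'Z(G) ->
  transfer G abA z = (FiniteModule.fmod abA (alpha z) *+ #|G : H|)%R.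
Proof.
move=> sHG Hz /centerP[Gz cGz]; rewrite /transfer -Algebra.sumr_const.
apply: eq_bigr => _ /rcosetsP[x Gx ->].
have -> : H :* x :* z = H :* x.
  by rewrite -rcosetM -cGz // rcosetM (rcoset_id Hz).
have Gr : repr (H :* x) \in G.
  by case: repr_rcosetP => h Hh; rewrite groupM // (subsetP sHG).
by rewrite -(cGz _ Gr) mulgK.
Qed.

(** The transfer from G to H / H' has an abelian target, so it kills z, while
    by [transfer_center] its value is the class of [z ^+ #|G : H|]. *)
Lemma der1_cap_center_expg_index (gT : finGroupType) (G H : {group gT}) z :
    H \subset G -> z \in H -> z \in G^`(1) -> z \in 'Z(G) ->
  z ^+ #|G : H| \in H^`(1).
Proof.
move=> sHG Hz G'z Zz.
pose alpha := restrm_morphism (der_norm 1 H) (coset_morphism H^`(1)).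
have abA : abelian (alpha @* H).
  by rewrite morphim_restrm setIid; apply: der_abelian.
have : z \in 'ker (transfer_morphism G abA).
  apply: (subsetP (der1_min _ _) z G'z); first exact: ker_norm.
  rewrite (isog_abelian (first_isog _)).
  by apply/centsP=> u _ v _; apply: FiniteModule.fmod_addrC.
move/mker; rewrite /= transfer_center //.
rewrite -FiniteModule.fmodX ?mem_morphim // -morphX //.
have Hzn : z ^+ #|G : H| \in H by apply: groupX.
move/(congr1 val); rewrite /= FiniteModule.fmodK ?(mem_morphim alpha) // => az1.
by apply: coset_idr => //; rewrite (subsetP (der_norm 1 H)).
Qed.

(** [#|G : P|] is prime to the order of z, so z is a power of
    [z ^+ #|G : P|]. *)
Lemma Sylow_der1_cap_center (gT : finGroupType) (p : nat) (G P : {group gT}) :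
  p.-Sylow(G) P -> G^`(1) :&: 'Z(G) :&: P \subset P^`(1).
Proof.
case/and3P=> sPG pP p'GP; apply/subsetP=> z /setIP[/setIP[G'z Zz] Pz].
have : z ^+ #|G : P| \in P^`(1) by apply: der1_cap_center_expg_index.
have co_zn : coprime #[z] #|G : P| := pnat_coprime (mem_p_elt pP Pz) p'GP.
move: co_zn; rewrite -generator_coprime => /eqP def_z.
by rewrite -!cycle_subG -def_z.
Qed.

(** * Orders of the derived subgroup and of its central part *)

(** For a Sylow p-subgroup P, the p-part of the left-hand side is the order of
    [G' :&: Z :&: P].  This is contained in [P' :&: A] for the central subgroup
    [A = Z :&: P] of P, and [P / A] is isomorphic to the subgroup [P / Z] of
    [G / Z]. *)
Lemma card_der1_cap_center_dvd (gT : finGroupType) (G : {group gT}) :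
  #|G^`(1) :&: 'Z(G)| %| #|G : 'Z(G)| ^ rk (G / 'Z(G)).
Proof.
have nZ := normal_norm (center_normal G).
apply/dvdn_partP=> // p _.
have [P sylP] := Sylow_exists p G; have sPG := pHall_sub sylP.
have sylGZ : p.-Sylow(G^`(1) :&: 'Z(G)) (G^`(1) :&: 'Z(G) :&: P).
  apply: Sylow_setI_normal sylP.
  by rewrite normalI ?der_normal ?center_normal.
have nZP := subset_trans sPG nZ.
pose A := ('Z(G) :&: P)%G.
have sAZ : A \subset 'Z(P).
  by rewrite subsetI subsetIr subIset // (subset_trans (subsetIr _ _)) ?centS.
have isoPA : P / 'Z(G) \isog P / A by rewrite isog_sym second_isog.
have dvPA : #|P : A| %| #|G : 'Z(G)|.
  rewrite -!card_quotient ?(normal_norm (sub_center_normal sAZ)) //.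
  by rewrite -(card_isog isoPA) cardSg ?quotientS.
rewrite -(card_Hall sylGZ); apply: dvdn_trans (dvdn_exp2r _ dvPA).
apply: dvdn_trans (card_der1_cap_central_dvd (p := p) sAZ _ _); first last.
- by rewrite -(isog_grank isoPA) grank_le_rk ?quotientS.
- by rewrite /= -(isog_pgroup p isoPA) quotient_pgroup ?(pHall_pgroup sylP).
rewrite cardSg // subsetI (Sylow_der1_cap_center sylP).
by rewrite /= -setIA subsetIr.
Qed.

Theorem theorem1 (gT : finGroupType) (G : {group gT}) :
  let r := rk (G / 'Z(G)) in
  (#|G^`(1)| <= #|G : 'Z(G)| ^ r.+1)%N.
Proof.
rewrite /=; apply: dvdn_leq; first by rewrite expn_gt0 indexg_gt0.
have nZ := normal_norm (center_normal G).
have nZ' : G^`(1) \subset 'N('Z(G)) := subset_trans (der_sub 1 G) nZ.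
rewrite -(LagrangeI G^`(1) 'Z(G)) expnSr dvdn_mul //.
  exact: card_der1_cap_center_dvd.
by rewrite -!card_quotient // cardSg ?quotientS ?der_sub.
Qed.
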